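(* Let $\rho=(\rho_1,\rho_2,\ldots)$ be a sequence of integers with $\rho_j\ge 1$ for all $j$, and suppose that $\rho_k>1$ for some $k$. Let $\Pi$ be a random partition of $\mathbb N$ which is constrained with respect to $\rho$. If $\Pi$ is exchangeable, then (with probability one) $\Pi$ has at most $k$ nonempty blocks.
   Context: $\mathbb N=\{1,2,\ldots\}$. A partition of $\mathbb N$ is a sequence $(b_1,b_2,\ldots)$ of pairwise disjoint subsets of $\mathbb N$ with union $\mathbb N$, such that $b_k=\varnothing$ implies $b_{k+1}=\varnothing$, and $b_{k+1}\ne\varnothing$ implies $\min b_k<\min b_{k+1}$ (blocks are listed in increasing order of their least elements). A random partition $\Pi=(B_1,B_2,\ldots)$ of $\mathbb N$ is a random variable with values in the set of partitions of $\mathbb N$, with the $\sigma$-algebra generated by the restrictions to $[n]=\{1,\ldots,n\}$, $n\ge1$. $\Pi$ is constrained with respect to $\rho$ if for every $k$ with $B_k\neq\varnothing$ the block $B_k$ contains the $\rho_k$ least elements of $\bigcup_{j\ge k}B_j$ (all elements of this set, if it has fewer than $\rho_k$ elements). $\Pi$ is exchangeable if its law is invariant under all bijections $\sigma:\mathbb N\to\mathbb N$, where $\sigma$ acts on a partition by mapping each block $b$ to $\sigma(b)$ and then relabelling the blocks in increasing order of their least elements. *)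

(* Defs.v *)
From HB Require Import structures.
From mathcomp Require Import all_boot all_order all_algebra.
From mathcomp Require Import all_classical all_reals all_analysis.

Set Implicit Arguments.
Unset Strict Implicit.
Unset Printing Implicit Defensive.

Local Open Scope classical_set_scope.

(* Only the order of the positive integers matters below, so they are
   represented by [nat], the integer i being encoded as i - 1.  Sequences are
   indexed from 0 in the same way: [b k] is the (k+1)-st block and [rho k] is
   the (k+1)-st bound.  The set {1, ..., n} becomes `I_n. *)

Definition is_least (A : set nat) (m : nat) : Prop :=
  A m /\ forall x, A x -> m <= x.

(* The r least elements of U; this is U itself when U has fewer than r
   elements. *)
Definition least_elements (r : nat) (U : set nat) : set nat :=
  [set n | U n /\ count [in U] (iota 0 n) < r].

Record is_npartition (b : nat -> set nat) : Prop := IsNPartition {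
  np_triv : trivIset setT b;
  np_cover : \bigcup_k b k = setT;
  np_empty : forall k, b k = set0 -> b k.+1 = set0;
  np_least : forall k, b k.+1 !=set0 ->
    forall m m', is_least (b k) m -> is_least (b k.+1) m' -> m < m' }.

Record npartition := NPartition {
  block :> nat -> set nat;
  npartitionP : is_npartition block }.

Lemma npartition_eq (b b' : npartition) : (forall k, b k = b' k) -> b = b'.
Proof.
case: b b' => [b pb] [b' pb'] /= /funext bb'.
by subst b'; congr NPartition; exact: Prop_irrelevance.
Qed.

Lemma one_block_npartition : is_npartition (fun k => if k is 0 then setT else set0).
Proof.
split=> [[|i] [|j] _ _ [x []]//| |[|k]//|k [x []//]].
- by apply/seteqP; split=> x // _; exists 0.
Qed.

HB.instance Definition _ := gen_eqMixin npartition.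
HB.instance Definition _ := gen_choiceMixin npartition.
HB.instance Definition _ := isPointed.Build npartition
  (NPartition one_block_npartition).

Definition restriction (n : nat) (b : npartition) : nat -> set nat :=
  fun k => b k `&` `I_n.

(* [restriction n] takes finitely many values, so that its target carries the
   discrete sigma-algebra. *)
Definition restriction_sets : set (set npartition) :=
  \bigcup_n preimage_set_system setT (restriction n) setT.

HB.instance Definition _ :=
  Measurable.copy npartition (g_sigma_algebraType restriction_sets).

Definition constrained (rho : nat -> nat) (b : npartition) : Prop :=
  forall k, b k !=set0 ->
    least_elements (rho k) (\bigcup_(j in [set j | k <= j]) b j) `<=` b k.

(* The nonempty sets among the c k, listed in increasing order of their least
   elements: the set with least element l comes in the position given by the
   number of least elements smaller than l. *)
Definition least_set (c : nat -> set nat) : set nat :=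
  [set l | exists k, is_least (c k) l].

Definition relabel (c : nat -> set nat) : nat -> set nat :=
  fun j => [set n | exists k l,
    [/\ c k n, is_least (c k) l & count [in least_set c] (iota 0 l) = j]].

Lemma is_least_ex (A : set nat) n : A n -> exists m, is_least A m.
Proof.
move=> An.
have exA : exists n, `[< A n >] by exists n; exact/asboolP.
case: (ex_minnP exA) => m /asboolP Am mP.
by exists m; split => // x Ax; apply: mP; exact/asboolP.
Qed.

Lemma is_least_uniq (A : set nat) m m' : is_least A m -> is_least A m' -> m = m'.
Proof.
by move=> [Am mP] [Am' m'P]; apply/eqP; rewrite eqn_leq mP ?m'P.
Qed.

Lemma count_iotaS (a : pred nat) l :
  count a (iota 0 l.+1) = count a (iota 0 l) + a l.
Proof. by rewrite -addn1 iotaD count_cat /= add0n addn0. Qed.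

Lemma count_iota_le (a : pred nat) l m :
  l <= m -> count a (iota 0 l) <= count a (iota 0 m).
Proof.
by move=> lm; rewrite -(subnKC lm) iotaD count_cat leq_addr.
Qed.

Lemma count_iota_lt (a : pred nat) l m :
  a l -> l < m -> count a (iota 0 l) < count a (iota 0 m).
Proof.
move=> al lm; apply: leq_trans (count_iota_le a lm).
by rewrite count_iotaS al addn1.
Qed.

Lemma count_iota_ex (a : pred nat) l j : j < count a (iota 0 l) ->
  exists2 m, a m & count a (iota 0 m) = j.
Proof.
elim: l => // l IH; rewrite count_iotaS.
case: (boolP (a l)) => al; rewrite ?addn0 ?addn1 // ltnS leq_eqVlt.
by case/orP => [/eqP ->|/IH//]; exists l.
Qed.

Lemma relabel_npartition (c : nat -> set nat) :
  trivIset setT c -> \bigcup_k c k = setT -> is_npartition (relabel c).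
Proof.
move=> ctriv ccov.
have same k k' n : c k n -> c k' n -> k = k'.
  by move=> ? ?; apply: ctriv => //; exists n.
have leastP k l : is_least (c k) l -> l \in least_set c.
  by move=> kl; rewrite inE; exists k.
have rank_inj k k' l l' : is_least (c k) l -> is_least (c k') l' ->
    count [in least_set c] (iota 0 l) = count [in least_set c] (iota 0 l') ->
    l = l'.
  move=> kl kl' E; case: (ltngtP l l') => // H.
  - by have := count_iota_lt (leastP _ _ kl) H; rewrite E ltnn.
  - by have := count_iota_lt (leastP _ _ kl') H; rewrite E ltnn.
have blockE k l : is_least (c k) l ->
    relabel c (count [in least_set c] (iota 0 l)) = c k.
  move=> kl; apply/seteqP; split=> n /=; last by move=> ckn; exists k, l.
  move=> [k' [l' [ck'n kl' E]]].
  have ll' := rank_inj _ _ _ _ kl' kl E; subst l'.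
  by rewrite (same k k' l) //; [exact: kl.1|exact: kl'.1].
split.
- move=> i j _ _ [n [[k [l [kn kl <-]]] [k' [l' [kn' kl' <-]]]]].
  have kk' := same _ _ _ kn kn'; subst k'.
  by rewrite (is_least_uniq kl kl').
- apply/seteqP; split=> // n _.
  have [k _ kn] : (\bigcup_k c k) n by rewrite ccov.
  have [l kl] := is_least_ex kn.
  by exists (count [in least_set c] (iota 0 l)) => //; exists k, l.
- move=> j j0; apply/seteqP; split=> // n [k [l [kn kl E]]].
  have [|m] := @count_iota_ex [in least_set c] l j; first by rewrite E.
  rewrite inE => -[k' k'm] mj.
  have : relabel c j m by rewrite -mj (blockE _ _ k'm); exact: k'm.1.
  by rewrite j0.
- move=> j _ m m' [[k [l [km kl Ej]]] Hm] [[k' [l' [km' kl' Ej']]] Hm'].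
  have ml : m <= l by apply: Hm; exists k, l; split=> //; exact: kl.1.
  have l'm' : l' <= m' by exact: kl'.2.
  apply: leq_ltn_trans ml _; apply: leq_trans l'm'.
  rewrite ltnNge; apply/negP => /(count_iota_le [in least_set c]).
  by rewrite Ej Ej' ltnn.
Qed.

Lemma image_npartition (s : nat -> nat) (hs : bijective s) (b : npartition) :
  is_npartition (relabel (fun k => s @` b k)).
Proof.
have [t st ts] := hs; have [triv cov _ _] := npartitionP b.
apply: relabel_npartition.
- move=> i j _ _ [_ [[x bix <-] [y bjy /(can_inj st) yx]]].
  by apply: triv => //; exists x; split=> //; rewrite -yx.
- apply/seteqP; split=> // n _.
  have [k _ bk] : (\bigcup_k b k) (t n) by rewrite cov.
  by exists k => //; exists (t n).
Qed.

Definition npartition_act (s : nat -> nat) (hs : bijective s) (b : npartition) :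
  npartition := NPartition (image_npartition hs b).

Lemma relabel_local (c c' : nat -> set nat) (n : nat) :
  (forall k, c k `&` `I_n = c' k `&` `I_n) ->
  forall j, relabel c j `&` `I_n = relabel c' j `&` `I_n.
Proof.
move=> cc'.
have cE k x : x < n -> c k x = c' k x.
  move=> xn; have := congr1 (fun A : set nat => A x) (cc' k).
  rewrite /setI /= => E; apply/propext; split=> H.
  - by have [] : c' k x /\ x < n by rewrite -E.
  - by have [] : c k x /\ x < n by rewrite E.
have leastE k l : l < n -> is_least (c k) l = is_least (c' k) l.
  move=> ln; apply/propext; rewrite /is_least cE //; split=> -[cl H];
    split=> // x; (case: (ltnP x n) => [xn|nx _]; last exact: leq_trans (ltnW ln) nx).
  - by rewrite -cE //; exact: H.
  - by rewrite cE //; exact: H.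
have countE l : l < n -> count [in least_set c] (iota 0 l) =
    count [in least_set c'] (iota 0 l).
  move=> ln; apply: eq_in_count => x; rewrite mem_iota add0n /= => xl.
  have xn := ltn_trans xl ln.
  by apply/idP/idP; rewrite !inE => -[k H]; exists k; move: H; rewrite leastE.
move=> j; apply/seteqP; split=> x [[k [l [cx cl E]]] xn]; split=> //;
  have ln : l < n by exact: leq_ltn_trans (cl.2 _ cx) xn.
- by exists k, l; rewrite -cE // -leastE // -countE.
- by exists k, l; rewrite cE // leastE // countE.
Qed.

Lemma npartition_act_measurable (s : nat -> nat) (hs : bijective s) :
  measurable_fun setT (npartition_act hs).
Proof.
apply: (@measurability _ _ _ _ _ _ restriction_sets) => //.
move=> _ [_ [n _ [S _ <-]] <-]; rewrite !setTI.
have [t st ts] := hs.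
pose N := \max_(i < n) (t i).+1.
have tN x : x < n -> t x < N.
  by move=> xn; rewrite (@leq_bigmax _ (fun i : 'I_n => (t i).+1) (Ordinal xn)).
have key b b' : restriction N b = restriction N b' ->
    restriction n (npartition_act hs b) = restriction n (npartition_act hs b').
  move=> E; apply/funext => j; apply: relabel_local => k.
  have {}E x : x < n -> b k (t x) <-> b' k (t x).
    move=> xn; have := congr1 (fun A => A k (t x)) E.
    rewrite /restriction /setI /= => {}E; split=> H.
    - by have [] : b' k (t x) /\ t x < N by rewrite -E; split=> //; exact: tN.
    - by have [] : b k (t x) /\ t x < N by rewrite E; split=> //; exact: tN.
  apply/seteqP; split=> _ [[x bx <-] sn]; split=> //; exists x => //.
  - by have := E _ sn; rewrite st => -[H _]; exact: H.
  - by have := E _ sn; rewrite st => -[_ H]; exact: H.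
apply: sub_sigma_algebra; exists N => //.
exists (restriction N @` (npartition_act hs @^-1` (restriction n @^-1` S))) => //.
rewrite setTI; apply/seteqP; split=> b /=; last by move=> H; exists b.
by move=> [b' Sb' /key <-].
Qed.

Lemma npartition_act_blocks (s : nat -> nat) (hs : bijective s) (b : npartition) :
  [set A | A !=set0 /\ exists j, A = npartition_act hs b j] =
  [set A | A !=set0 /\ exists k, A = s @` b k].
Proof.
have [t st _] := hs.
have blockE k l : is_least (s @` b k) l ->
    npartition_act hs b (count [in least_set (fun k => s @` b k)] (iota 0 l)) =
    s @` b k.
  move=> kl; set j := count _ _.
  have sub k' l' : is_least (s @` b k') l' ->
      count [in least_set (fun k => s @` b k)] (iota 0 l') = j -> l' = l.
    move=> kl' E; have lP i m : is_least (s @` b i) m ->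
      m \in least_set (fun k => s @` b k) by move=> im; rewrite inE; exists i.
    case: (ltngtP l' l) => // H.
    - by have := count_iota_lt (lP _ _ kl') H; rewrite E ltnn.
    - by have := count_iota_lt (lP _ _ kl) H; rewrite E ltnn.
  apply/seteqP; split=> n /=; last by move=> bn; exists k, l.
  move=> [k' [l' [bn kl' /(sub _ _ kl') ll']]]; subst l'.
  have [x bx xl] := kl.1; have [y by_ yl] := kl'.1.
  have xy : x = y by apply: (can_inj st); rewrite xl.
  have -> // : k = k'.
  by apply: (np_triv (npartitionP b)) => //; exists x; split=> //; rewrite xy.
apply/seteqP; split=> A [A0 [i Ai]]; split=> //; subst A.
- have [n [k [l [_ kl E]]]] := A0.
  by exists k; rewrite -E; exact: blockE.
- have [n /is_least_ex [l il]] := A0.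
  by eexists; rewrite -(blockE _ _ il).
Qed.

HB.instance Definition _ (s : nat -> nat) (hs : bijective s) :=
  isMeasurableFun.Build _ _ npartition npartition (npartition_act hs)
    (npartition_act_measurable hs).

Definition exchangeable d (T : measurableType d) (R : realType)
    (P : probability T R) (Pi : {RV P >-> npartition}) : Prop :=
  forall (s : nat -> nat) (hs : bijective s) (A : set npartition),
    measurable A ->
    distribution P (npartition_act hs \o Pi) A = distribution P Pi A.

(* Main.v *)
Require Import Defs.
From mathcomp Require Import all_boot all_order all_algebra.
From mathcomp Require Import all_classical all_reals all_analysis.
Local Open Scope classical_set_scope.
Local Open Scope card_scope.

(** Let a and b be the least elements of the blocks k and k+1 (counted from 0)
of a constrained partition, and c the second least element of the union of the
blocks with index at least k.  As rho k > 1, c lies in the block k, hence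
a < c < b.  Exchanging a and b therefore separates c from a in the block k,
so that the new partition is no longer constrained, and the event that this
happens for given a, b and c is null by exchangeability. *)

(** * Order of the blocks and of their least elements *)

Lemma npartition_nonempty {b : npartition} {i j n} :
  i <= j -> b j n -> b i !=set0.
Proof.
move=> ij; move: n; rewrite -(subnKC ij).
elim: (j - i)%N => [|l IH] n; rewrite ?addn0 ?addnS => bn; first by exists n.
case: (pselect (b (i + l) = set0)) => [b0|/eqP/set0P[x /IH//]].
by move: bn; rewrite (np_empty (npartitionP b) b0).
Qed.

Lemma npartition_least_le {b : npartition} {i j m n} :
  i <= j -> is_least (b i) m -> b j n -> m <= n.
Proof.
move=> ij im; move: n; rewrite -(subnKC ij).
elim: (j - i)%N => [|l IH] n; rewrite ?addn0 ?addnS => bn; first exact: im.2.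
have [m' Hm'] := is_least_ex bn.
have [x /is_least_ex[m1 Hm1]] := npartition_nonempty (leqnSn _) bn.
have m1m' : m1 < m' by apply: (np_least (npartitionP b) _ Hm1 Hm'); exists n.
exact: leq_trans (IH _ Hm1.1) (leq_trans (ltnW m1m') (Hm'.2 _ bn)).
Qed.

Lemma npartition_same {b : npartition} {i j n} : b i n -> b j n -> i = j.
Proof.
by move=> bi bj; apply: (np_triv (npartitionP b)) => //; exists n.
Qed.

Lemma npartition_cover (b : npartition) n : exists j, b j n.
Proof.
have [j _ bj] : (\bigcup_k b k) n by rewrite (np_cover (npartitionP b)).
by exists j.
Qed.

(** Least elements increase with the index, so between those of two consecutive blocks there is no
    other. This identifies the rank computed by [relabel] with the index of a block. *)
Lemma count_least_set {b : npartition} {k m} : is_least (b k) m ->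
  count [in least_set b] (iota 0 m) = k.
Proof.
elim: k m => [|k IH] m km.
  apply/eqP; rewrite -leqn0 leqNgt -has_count; apply/hasPn => x.
  rewrite mem_iota add0n /= => xm; apply/negP; rewrite inE => -[j jx].
  by have := npartition_least_le (leq0n j) km jx.1; rewrite leqNgt xm.
have [x /is_least_ex[l kl]] := npartition_nonempty (leqnSn k) km.1.
have lm : l < m.
  by apply: (np_least (npartitionP b) _ kl km); exists m; exact: km.1.
rewrite -(subnKC lm) iotaD count_cat count_iotaS (IH _ kl).
have -> : l \in least_set b by rewrite inE; exists k.
rewrite addn1 -[RHS]addn0; congr addn.
apply/eqP; rewrite -leqn0 leqNgt -has_count; apply/hasPn => y.
rewrite mem_iota add0n subnKC // => /andP[ly ym].
apply/negP; rewrite inE => -[j jy].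
case: (ltngtP j k) => [jk|kj|jk].
- by have := npartition_least_le (ltnW jk) jy kl.1; rewrite leqNgt ly.
- by have := npartition_least_le kj km jy.1; rewrite leqNgt ym.
- by subst j; move: ly; rewrite (is_least_uniq jy kl) ltnn.
Qed.

(** * Effect of a transposition on a partition *)

Definition swap (a b n : nat) : nat :=
  if n == a then b else if n == b then a else n.

Lemma swapK a b : involutive (swap a b).
Proof.
move=> n; rewrite /swap.
case: (eqVneq n a) => [->|na]; last case: (eqVneq n b) => [->|nb].
- by rewrite eqxx; case: eqVneq.
- by rewrite eqxx.
- by rewrite (negbTE na) (negbTE nb).
Qed.

Lemma swap_bij a b : bijective (swap a b).
Proof. exact: inv_bij (swapK a b). Qed.

Lemma image_swap a b (A : set nat) n : (swap a b @` A) n <-> A (swap a b n).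
Proof.
by split=> [[x Ax <-]|An]; [rewrite swapK|exists (swap a b n); rewrite ?swapK].
Qed.

Lemma swap_id {a b n} : n <> a -> n <> b -> swap a b n = n.
Proof. by rewrite /swap; do 2 case: eqP => //. Qed.

Section SwapLeast.
Context {p : npartition} {k a b : nat}.
Hypotheses (ka : is_least (p k) a) (kb : is_least (p k.+1) b).

Let ab : a < b.
Proof.
by apply: (np_least (npartitionP p) _ ka kb); exists b; exact: kb.1.
Qed.

Let neq_a {j n} : j < k -> p j n -> n <> a.
Proof.
move=> jk jn na; rewrite na in jn.
by move: jk; rewrite (npartition_same jn ka.1) ltnn.
Qed.

Let neq_b {j n} : j <= k -> p j n -> n <> b.
Proof.
move=> jk jn nb; rewrite nb in jn.
by move: jk; rewrite (npartition_same jn kb.1) ltnn.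
Qed.

(** As [a < b], the transposition fixes every point below [a], so the same points below [l] are
    least in a block before and after it. *)
Let count_swap l : l <= a ->
  count [in least_set (fun j => swap a b @` p j)] (iota 0 l) =
  count [in least_set p] (iota 0 l).
Proof.
move=> la; apply: eq_in_count => x; rewrite mem_iota add0n /= => xl.
have xa := leq_trans xl la.
have imE j y : y < a -> (swap a b @` p j) y <-> p j y.
  move=> ya; have yb := ltn_trans ya ab.
  by rewrite image_swap swap_id //; apply/eqP; rewrite ltn_eqF.
apply/idP/idP; rewrite !inE => -[j [jx H]]; exists j; split;
  try exact/imE; move=> y jy; case: (ltnP y a) => [ya|ay];
  try exact: leq_trans (ltnW xa) ay; by apply: H; apply/imE.
Qed.

(** Relabelling changes only the indices of the image blocks; arguing on pairs of points avoids
    computing those indices. *)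
Lemma swap_same_block {i m n} :
  npartition_act (swap_bij a b) p i m -> npartition_act (swap_bij a b) p i n ->
  exists j, p j (swap a b m) /\ p j (swap a b n).
Proof.
move=> im i_n; set q := npartition_act _ _ in im i_n.
have : [set A | A !=set0 /\ exists j, A = q j] (q i).
  by split; [exists m|exists i].
rewrite npartition_act_blocks => -[_ [j qj]].
by exists j; rewrite -!image_swap -qj.
Qed.

(** Such a block contains neither [a] nor [b], and its least element keeps its rank. *)
Lemma swap_block_lt {j x} : j < k -> p j x ->
  npartition_act (swap_bij a b) p j x.
Proof.
move=> jk jx; have [l jl] := is_least_ex jx.
have inim y : p j y -> (swap a b @` p j) y.
  by move=> jy; rewrite image_swap (swap_id (neq_a jk jy) (neq_b (ltnW jk) jy)).
exists j, l; split; first exact: inim.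
- split; first exact: inim jl.1.
  move=> _ [y jy <-]; rewrite (swap_id (neq_a jk jy) (neq_b (ltnW jk) jy)).
  exact: jl.2.
- rewrite count_swap; last exact: npartition_least_le (ltnW jk) jl ka.1.
  exact: count_least_set.
Qed.

(** The image of the block [k.+1] has least element [a], and so inherits the rank [k] of [a]. *)
Lemma swap_block_least : npartition_act (swap_bij a b) p k a.
Proof.
have bim : (swap a b @` p k.+1) a.
  by rewrite image_swap /swap eqxx; exact: kb.1.
exists k.+1, a; split => //; last by rewrite count_swap // (count_least_set ka).
split=> // x; rewrite image_swap leqNgt => px; apply/negP => xa.
have xb := ltn_trans xa ab.
move: px; rewrite swap_id; [|by apply/eqP; rewrite ltn_eqF..].
by move/kb.2; rewrite leqNgt xb.
Qed.

(** The point [c] is fixed, while [a] comes from [b]: sharing a block would put [b] and [c] in one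
    block of [p]. *)
Lemma swap_notin_block {c} : p k c -> c <> a ->
  ~ npartition_act (swap_bij a b) p k c.
Proof.
move=> kc ca qc.
have cb := neq_b (leqnn k) kc.
have [j []] := swap_same_block qc swap_block_least.
rewrite (swap_id ca cb) /swap eqxx => jc jb.
apply: (n_Sn k).
exact: etrans (npartition_same kc jc) (npartition_same jb kb.1).
Qed.

Lemma swap_notin_block_lt {j c} : j < k -> p k c -> c <> a ->
  ~ npartition_act (swap_bij a b) p j c.
Proof.
move=> jk kc ca qc.
have cb := neq_b (leqnn k) kc.
have [x jx] := npartition_nonempty (ltnW jk) kc.
have [i []] := swap_same_block qc (swap_block_lt jk jx).
rewrite (swap_id ca cb) => ic.
have {}ik : i = k by exact: npartition_same ic kc.
subst i; rewrite (swap_id (neq_a jk jx) (neq_b (ltnW jk) jx)).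
by move=> kx; move: jk; rewrite (npartition_same jx kx) ltnn.
Qed.

End SwapLeast.

(** * The event that the constraint is visibly violated *)

Lemma count_iota_le1 (u : pred nat) c a :
  (forall x, x < c -> u x -> x = a) -> count u (iota 0 c) <= 1.
Proof.
move=> ua; apply: (@leq_trans (count_mem a (iota 0 c))); last first.
  by rewrite count_uniq_mem ?iota_uniq // leq_b1.
rewrite -!size_filter; apply: uniq_leq_size; first exact/filter_uniq/iota_uniq.
move=> x; rewrite !mem_filter /= mem_iota add0n /= => /andP[ux xc].
by rewrite (ua x xc ux) eqxx -(ua x xc ux).
Qed.

(* For a partition with blocks f: a lies in the block k, and c in a later block,
although a is the only element below c of the blocks with index at least k.
This is phrased with elements x <= c only, so that it defines a measurable
event. *)
Definition separated (k a c : nat) (f : nat -> set nat) : Prop :=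
  [/\ f k a, ~ f k c, forall j, j < k -> ~ f j c &
      forall x, x < c -> x <> a -> exists2 j, j < k & f j x].

(** Here [c] has at most one predecessor in the union of the blocks from [k] on, so [1 < rho k]
    would force it into the block [k]. *)
Lemma separated_not_constrained rho k a c (p : npartition) :
  1 < rho k -> separated k a c p -> ~ constrained rho p.
Proof.
move=> rk [ka kc ltc ltx] /(_ k (ex_intro _ a ka)) H; apply: kc; apply: H.
split.
  have [j jc] := npartition_cover p c; exists j => //=.
  by rewrite leqNgt; apply/negP => /ltc.
apply: leq_ltn_trans rk; apply: (@count_iota_le1 _ _ a) => x xc.
rewrite inE => -[j /= kj jx]; apply: contrapT => xa.
have [i ik ix] := ltx _ xc xa.
by move: ik; rewrite (npartition_same ix jx) ltnNge kj.
Qed.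

Lemma measurable_separated k a c :
  measurable [set p : npartition | separated k a c (restriction c.+1 p)].
Proof.
apply: sub_sigma_algebra; exists c.+1 => //.
by exists [set f | separated k a c f] => //; rewrite setTI.
Qed.

Lemma separated_restriction k a c (p : npartition) : a <= c ->
  separated k a c (restriction c.+1 p) <-> separated k a c p.
Proof.
move=> ac; rewrite /separated /restriction /setI /=.
split=> -[H1 H2 H3 H4]; split.
- exact: H1.1.
- by move=> kc; apply: H2.
- by move=> j jk jc; apply: (H3 j jk); split.
- by move=> x xc xa; have [j jk []] := H4 x xc xa; exists j.
- by split.
- by case.
- by move=> j jk [jc _]; exact: (H3 j jk).
- move=> x xc xa; have [j jk jx] := H4 x xc xa; exists j => //.
  by split=> //; exact: ltnW.
Qed.

Lemma swap_separated rho k (p : npartition) a b :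
  1 < rho k -> constrained rho p -> is_least (p k) a -> is_least (p k.+1) b ->
  exists2 c, a <= c & separated k a c (npartition_act (swap_bij a b) p).
Proof.
move=> rk pc ka kb.
pose U := \bigcup_(j in [set j | k <= j]) p j.
have ab : a < b.
  by apply: (np_least (npartitionP p) _ ka kb); exists b; exact: kb.1.
have Ub : (U `\ a) b.
  split; first by exists k.+1 => //=; exact: kb.1.
  by move=> /= ba; rewrite ba ltnn in ab.
(* The point [b] witnesses that [U] has an element other than [a]; [c] is the least one. *)
have [c [[Uc /= ca] cP]] := is_least_ex Ub.
have ltc x : x < c -> x <> a -> exists2 j, j < k & p j x.
  move=> xc xa; have [j jx] := npartition_cover p x; exists j => //.
  rewrite ltnNge; apply/negP => kj.
  have : c <= x by apply: cP; split=> //; exists j.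
  by rewrite leqNgt xc.
have [i /= ki ic] := Uc.
have ac : a <= c by exact: npartition_least_le ki ka ic.
have kc : p k c.
  apply: (pc k (ex_intro _ a ka.1)); split=> //.
  apply: leq_ltn_trans rk; apply: (@count_iota_le1 _ _ a) => x xc.
  rewrite inE => Ux; apply: contrapT => xa.
  by have : c <= x by [apply: cP]; rewrite leqNgt xc.
exists c => //; split.
- exact: swap_block_least.
- exact: (swap_notin_block ka kb kc ca).
- by move=> j jk; exact: (swap_notin_block_lt ka kb jk kc ca).
- move=> x xc xa; have [j jk jx] := ltc x xc xa; exists j => //.
  exact: (swap_block_lt ka kb jk jx).
Qed.

(** * Almost sure bound on the number of blocks *)

Theorem proposition2 (d : measure_display) (T : measurableType d)
    (R : realType) (P : probability T R) (rho : nat -> nat) (k : nat)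
    (Pi : {RV P >-> npartition}) :
  (forall j, 1 <= rho j) ->
  1 < rho k ->
  {ae P, forall w, constrained rho (Pi w)} ->
  exchangeable Pi ->
  {ae P, forall w, [set j | Pi w j !=set0] #<= `I_k.+1}.
Proof.
move=> _ rk aec exch.
pose N a c := [set p : npartition | separated k a c (restriction c.+1 p)].
have N0 a b c : a <= c ->
    {ae P, forall w, ~ N a c (npartition_act (swap_bij a b) (Pi w))}.
  move=> ac.
  have mN : measurable (N a c) by exact: measurable_separated.
  (* Exchangeability replaces the swapped partition by [Pi], for which the event lies in the null
     set where the constraint fails. *)
  have PN : distribution P (npartition_act (swap_bij a b) \o Pi) (N a c) = 0%E.
    rewrite exch // /distribution /pushforward; apply: measure_negligible.
      by rewrite -[X in measurable X]setTI; exact: measurable_funPT.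
    apply: negligibleS aec => w /= /separated_restriction - /(_ ac).
    exact: separated_not_constrained.
  exists ((npartition_act (swap_bij a b) \o Pi) @^-1` N a c); split.
  - by rewrite -[X in measurable X]setTI; exact: measurable_funPT.
  - exact: PN.
  - by move=> w /= /contrapT.
(* The points [a], [b], [c] depend on [w]; there are countably many triples, so one null set serves
   them all. *)
have N1 : {ae P, forall w, forall a b c, a <= c ->
    ~ N a c (npartition_act (swap_bij a b) (Pi w))}.
  apply/ae_foralln => a; apply/ae_foralln => b; apply/ae_foralln => c.
  case: (leqP a c) => ac; last exact: nearW.
  by apply: filterS (N0 a b c ac).
apply: filterS2 aec N1 => w cw Nw.
(* A nonempty block of index above [k] makes the blocks [k] and [k.+1] nonempty, as the swap
   requires. Indices start at 0, whence the bound [k.+1]. *)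
apply: subset_card_le => j /= -[n jn]; rewrite ltnNge; apply/negP => kj.
have [x kx] := npartition_nonempty kj jn.
have [b kb] := is_least_ex kx.
have [y ky] := npartition_nonempty (leqnSn k) kx.
have [a ka] := is_least_ex ky.
have [c ac sep] := swap_separated _ _ _ _ _ rk cw ka kb.
by apply: (Nw a b c ac); rewrite /N /= separated_restriction.
Qed.
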